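(* Let $\mathcal{I}$ be an ideal on $\omega$. Then the following statements are equivalent: (a) $\mathcal{I}$ is Ramsey. (b) $\mathcal{I}^+\longrightarrow(\omega,\mathcal{I}^+)^n_2$ holds for all $n\geq 3$. (c) $\mathcal{I}^+\longrightarrow(<\omega,\mathcal{I}^+)^n_2$ holds for all $n\geq 3$. (d) $\mathcal{I}^+\longrightarrow(m,\mathcal{I}^+)^n_2$ holds for all integers $m>n\geq 3$.
   Context: An ideal on $\omega$ is a family $\mathcal{I}\subseteq\wp(\omega)$ containing all finite sets, with $\omega\notin\mathcal{I}$, closed under subsets and finite unions. $\mathcal{I}^+$ is the family of infinite subsets of $\omega$ not in $\mathcal{I}$. $[A]^n$ is the family of subsets of $A$ of size $n$, and $\pi''[B]^n$ denotes the image of $[B]^n$ under $\pi$. $\mathcal{I}$ is Ramsey if for every $A\in\mathcal{I}^+$ and every $\pi:[A]^2\to 2$ there is $H\in\mathcal{I}^+$, $H\subseteq A$, such that $\pi$ is constant on $[H]^2$. Fix $n\ge 2$. The following relations mean that for every $A\in\mathcal{I}^+$ and every coloring $\pi:[A]^n\to 2$, the stated alternative holds. - $\mathcal{I}^+\longrightarrow(\omega,\mathcal{I}^+)^n_2$: either there is an infinite $B\subseteq A$ with $\pi''[B]^n=\{0\}$, or there is $B\in\mathcal{I}^+$, $B\subseteq A$, with $\pi''[B]^n=\{1\}$. - $\mathcal{I}^+\longrightarrow(<\omega,\mathcal{I}^+)^n_2$: either for each $m$ with $n<m<\omega$ there is $B\in[A]^m$ with $\pi''[B]^n=\{0\}$,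 or there is $B\in\mathcal{I}^+$, $B\subseteq A$, with $\pi''[B]^n=\{1\}$. - $\mathcal{I}^+\longrightarrow(m,\mathcal{I}^+)^n_2$ (for a fixed $m$ with $n<m<\omega$): either there is $B\in[A]^m$ with $\pi''[B]^n=\{0\}$, or there is $B\in\mathcal{I}^+$, $B\subseteq A$, with $\pi''[B]^n=\{1\}$. *)

(* Defs.v *)
From mathcomp Require Import all_boot finmap.
From mathcomp Require Import boolp classical_sets cardinality.

Set Implicit Arguments.
Unset Strict Implicit.
Unset Printing Implicit Defensive.

Local Open Scope classical_set_scope.

Record ideal_on_omega (I : set (set nat)) : Prop := IdealOnOmega {
  ideal_finite : forall A, finite_set A -> I A;
  ideal_proper : ~ I setT;
  ideal_subset : forall A B, A `<=` B -> I B -> I A;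
  ideal_union : forall A B, I A -> I B -> I (A `|` B) }.

Definition positive (I : set (set nat)) : set (set nat) :=
  [set A | infinite_set A /\ ~ I A].

Definition nsubsets (A : set nat) (n : nat) : set {fset nat} :=
  [set s | [set` s] `<=` A /\ #|` s|%fset = n].

(* A coloring of [A]^n with colors 0 and 1 is represented by a total map
   pi : {fset nat} -> bool, with 0 as [false] and 1 as [true]; only its values
   on [nsubsets A n] are ever used. *)

Definition ramsey_ideal (I : set (set nat)) : Prop :=
  forall A, positive I A -> forall pi : {fset nat} -> bool,
  exists H, [/\ positive I H, H `<=` A &
    exists c, forall s, nsubsets H 2 s -> pi s = c].

Definition positive_homogeneous_one (I : set (set nat)) (n : nat)
    (A : set nat) (pi : {fset nat} -> bool) : Prop :=
  exists B, [/\ positive I B, B `<=` A & pi @` nsubsets B n = [set true]].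

Definition finite_homogeneous_zero (n m : nat)
    (A : set nat) (pi : {fset nat} -> bool) : Prop :=
  exists B, nsubsets A m B /\ pi @` nsubsets [set` B] n = [set false].

Definition arrow_omega (I : set (set nat)) (n : nat) : Prop :=
  forall A, positive I A -> forall pi : {fset nat} -> bool,
  (exists B, [/\ infinite_set B, B `<=` A &
     pi @` nsubsets B n = [set false]]) \/
  positive_homogeneous_one I n A pi.

Definition arrow_lt_omega (I : set (set nat)) (n : nat) : Prop :=
  forall A, positive I A -> forall pi : {fset nat} -> bool,
  (forall m, (n < m)%N -> finite_homogeneous_zero n m A pi) \/
  positive_homogeneous_one I n A pi.

Definition arrow_finite (I : set (set nat)) (m n : nat) : Prop :=
  forall A, positive I A -> forall pi : {fset nat} -> bool,
  finite_homogeneous_zero n m A pi \/ positive_homogeneous_one I n A pi.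

(* Main.v *)
Require Import Defs.
From mathcomp Require Import all_boot finmap.
From mathcomp Require Import boolp classical_sets cardinality.

(** A Ramsey ideal satisfies more than (b): every coloring of n-subsets of a
    positive set has a positive homogeneous set ([ramsey_homogeneous_arrow]).
    The induction on n replaces the tree argument of the classical Ramsey
    theorem by two consequences of the case n = 2:
    - sequential compactness along positive sets ([ramsey_convergence]): any
      sequence of points of the Cantor space converges along a positive set.
      Applied to the points x_b = (s |-> pi (s U {b})), it yields a limit
      coloring of n-subsets, which is made constant by the induction
      hypothesis;
    - sparseness ([ramsey_sparse]): a positive set may be thinned, staying
      positive, so that its gaps dominate a given function. With sufficiently
      large gaps, the color of an (n+1)-subset is the limit color of that
      subset without its maximum, so pi itself becomes constant.

    From (b) to (c) it suffices to take finite subsets of the infinite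
    homogeneous set, and (d) is (c) for one size at a time.

    The implication from (d) to (a) uses only m = 4 and n = 3. Given a coloring
    pi of pairs, color a triple a < u < v by whether pi {a,u} = pi {a,v}. Among
    the three pairs joining the least point of a 4-set to the others, two have
    the same color, so that no 4-set has only triples of color 0
    ([min_uniform_four]). A positive set whose triples all have color 1 is one
    on which pi {a,b} depends only on min(a,b); splitting it according to that
    dependence leaves a positive part, which is homogeneous
    ([arrow_finite_ramsey]). *)

Local Open Scope fset_scope.
Local Open Scope classical_set_scope.
Local Open Scope nat_scope.

(** * Finite subsets of infinite sets of naturals *)

Lemma infinite_has_nsubset (A : set nat) (n : nat) :
  infinite_set A -> exists s, nsubsets A n s.
Proof.
move=> Ainf; have [B BA leB] := infinite_set_fset n Ainf.
exists [fset x in take n B]; split=> [x /=|].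
  by rewrite inE => /mem_take xB; apply: BA.
by rewrite card_fseq undup_id ?take_uniq ?fset_uniq // size_takel.
Qed.

Lemma infinite_nat_ge (A : set nat) (N : nat) :
  infinite_set A -> exists2 a, A a & N <= a.
Proof.
move=> Ainf; apply: contrapT => noA; apply: Ainf.
apply: (@sub_finite_set _ _ `I_N); last exact: finite_II.
by move=> a Aa /=; rewrite ltnNge; apply/negP => Na; apply: noA; exists a.
Qed.

Lemma fset_nat_min (s : {fset nat}) : s != fset0 ->
  exists2 a, a \in s & forall x, x \in s -> a <= x.
Proof.
move/fset0Pn => exs; have [a as_ amin] := ex_minnP exs.
by exists a.
Qed.

Lemma fset_nat_max (s : {fset nat}) : s != fset0 ->
  exists2 b, b \in s & forall x, x \in s -> x <= b.
Proof.
move/fset0Pn => exs.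
have ubs x : x \in s -> x <= \max_(y <- s) y.
  by move=> xs; apply: (leq_bigmax_seq (F := id)).
have [b bs bmax] := ex_maxnP exs ubs.
by exists b.
Qed.

(** * Compactness and sparseness along positive sets *)

(** Lets colorings of pairs be given as functions of the smaller and the larger
    element. *)
Lemma ramsey_pairs I A (f : nat -> nat -> bool) :
  ramsey_ideal I -> positive I A ->
  exists H, [/\ positive I H, H `<=` A &
    exists c, forall a b, H a -> H b -> a < b -> f a b = c].
Proof.
move=> ramI posA.
(* Quantifying over the increasing pairs in s reads off the color of s without
   having to recover a and b from the set {a, b}. *)
have [H [posH HA [c homH]]] := ramI A posA
  (fun s => `[< forall a b, a \in s -> b \in s -> a < b -> f a b >]).
exists H; split=> //; exists c => a b Ha Hb ltab.
rewrite -(homH [fset a; b]).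
  apply/idP/asboolP => [fab a' b'|->//]; last 2 first.
  - by rewrite !inE eqxx.
  - by rewrite !inE eqxx orbT.
  rewrite !inE => /orP[] /eqP -> /orP[] /eqP -> //; first by rewrite ltnn.
    by rewrite ltnNge ltnW.
  by rewrite ltnn.
split; last by rewrite cardfs2 neq_ltn ltab.
by move=> x /=; rewrite !inE => /orP[] /eqP ->.
Qed.

(** Comparing x_a and x_b lexicographically for a < b is a coloring of pairs, as
    in Sierpinski's coloring; on a homogeneous set the sequence is
    lexicographically monotone, and a monotone sequence in the Cantor space
    converges coordinatewise. The comparison is coded by the value of x_b at the
    first coordinate where x_a and x_b differ. *)
Lemma ramsey_convergence I A (x : nat -> nat -> bool) :
  ramsey_ideal I -> positive I A ->
  exists B, [/\ positive I B, B `<=` A &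
    forall k, exists v N, forall b, B b -> N <= b -> x b k = v].
Proof.
move=> ramI posA.
pose first_diff a b k := x a k != x b k /\ forall j, j < k -> x a j = x b j.
have [B [posB BA [c homB]]] := ramsey_pairs I A
  (fun a b => `[< forall k, first_diff a b k -> x b k >]) ramI posA.
exists B; split=> // k; elim/ltn_ind: k => k IHk.
have [N stabN] : exists N, forall j, j < k ->
    forall a b, B a -> B b -> N <= a -> N <= b -> x a j = x b j.
  elim: k IHk => [|k IH] IHk; first by exists 0.
  have [N stabN] := IH (fun j jk => IHk j (ltnW jk)).
  have [v [M stabM]] := IHk k (ltnSn k).
  exists (maxn N M) => j; rewrite ltnS leq_eqVlt => /orP[/eqP ->|jk] a b Ba Bb;
    rewrite !geq_max => /andP[Na Ma] /andP[Nb Mb]; first by rewrite !stabM.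
  exact: stabN.
(* Once the coordinates below k are frozen, a change at coordinate k happens at
   the first difference, so it can only go from ~~ c to c. *)
have keep a b : B a -> B b -> N <= a -> a < b -> x a k = c -> x b k = c.
  move=> Ba Bb Na ab xa; apply/eqP/negPn/negP => xb.
  have diffk : first_diff a b k.
    split=> [|j jk]; first by rewrite xa eq_sym.
    by apply: stabN => //; apply: leq_trans (ltnW ab).
  have uniqk l : first_diff a b l -> l = k.
    case: diffk => nk eqk [nl eql].
    case: (ltngtP l k) => // lk; first by rewrite (eqk _ lk) eqxx in nl.
    by rewrite (eql _ lk) eqxx in nk.
  move/negP: xb; apply; rewrite -(homB a b) //; apply/eqP.
  by apply/idP/asboolP => [xbk l /uniqk ->|]; last exact.
have [[a [Ba Na xa]]|none] := pselect (exists a, [/\ B a, N <= a & x a k = c]).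
  by exists c, a.+1 => b Bb ab; apply: (keep a).
exists (~~ c), N => b Bb Nb.
have : x b k != c by apply/eqP => xb; apply: none; exists b.
by case: (x b k); case: c {homB keep none}.
Qed.

(** * Homogeneous sets for n-subsets *)

(** The convergence takes place in the Cantor space indexed by the countable set
    of finite sets s; N s is a modulus of convergence at s. *)
Lemma ramsey_limit_coloring I A (pi : {fset nat} -> bool) :
  ramsey_ideal I -> positive I A ->
  exists B (lim : {fset nat} -> bool) (N : {fset nat} -> nat),
    [/\ positive I B, B `<=` A &
      forall s b, B b -> N s <= b -> pi (b |` s)%fset = lim s].
Proof.
move=> ramI posA.
have [B [posB BA cvgB]] := ramsey_convergence I A
  (fun b k => if choice.unpickle k is Some s then pi (b |` s)%fset else false) ramI posA.
have cvgs s : exists vN : bool * nat,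
    forall b, B b -> vN.2 <= b -> pi (b |` s)%fset = vN.1.
  have [v [N HN]] := cvgB (choice.pickle s); exists (v, N) => b Bb Nb.
  by have := HN b Bb Nb; rewrite choice.pickleK.
have [g Hg] := choice cvgs.
by exists B, (fun s => (g s).1), (fun s => (g s).2); split.
Qed.

(** On a set homogeneous for the coloring h a <= b of the pairs a < b, the color
    cannot be false: that would bound the set by h a. *)
Lemma ramsey_sparse I A (h : nat -> nat) :
  ramsey_ideal I -> positive I A ->
  exists D, [/\ positive I D, D `<=` A &
    forall a b, D a -> D b -> a < b -> h a <= b].
Proof.
move=> ramI posA.
have [D [posD DA [c homD]]] := ramsey_pairs I A (fun a b => h a <= b) ramI posA.
exists D; split=> // a b Da Db ab; rewrite (homD a b) //.
have [d Dd] := infinite_nat_ge D (maxn a.+1 (h a)) posD.1.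
by rewrite geq_max => /andP[ad had]; rewrite -(homD a d).
Qed.

Definition homogeneous_arrow I n := forall A, positive I A ->
  forall pi : {fset nat} -> bool, exists H, [/\ positive I H, H `<=` A &
    exists c, forall s, nsubsets H n s -> pi s = c].

(** An (n+1)-set s with maximum b has color lim (s minus b) as soon as b is
    beyond the modulus at s minus b. As n > 0, s minus b has a maximum a, and
    gaps larger than all moduli at subsets of [0, a] suffice. *)
Lemma homogeneous_arrowS I n :
  ramsey_ideal I -> 0 < n -> homogeneous_arrow I n -> homogeneous_arrow I n.+1.
Proof.
move=> ramI n_gt0 arrI A posA pi.
have [B [lim [N [posB BA limB]]]] := ramsey_limit_coloring I A pi ramI posA.
have [C [posC CB [c homC]]] := arrI B posB lim.
pose h a := \max_(s <- fpowerset [fset x in iota 0 a.+1]) N s.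
have [D [posD DC sparseD]] := ramsey_sparse I C h ramI posC.
exists D; split=> //; first by move=> x /DC/CB/BA.
exists c => s [sD cards].
have [|b bs bmax] := fset_nat_max s; first by rewrite -cardfs_gt0 cards.
have cards' : #|` (s `\ b)%fset| = n by move: cards; rewrite (cardfsD1 b) bs => -[].
have [|a as' amax] := fset_nat_max (s `\ b)%fset; first by rewrite -cardfs_gt0 cards'.
have [nab a_s] : a != b /\ a \in s by move: as'; rewrite !inE => /andP[].
have ab : a < b by rewrite ltn_neqAle nab bmax.
rewrite -(fsetD1K bs) limB; first last.
- apply: leq_trans (sparseD a b (sD _ a_s) (sD _ bs) ab).
  rewrite /h; apply: (leq_bigmax_seq (F := N)) => //.
  rewrite fpowersetE; apply/fsubsetP => x /amax xa.
  by rewrite !inE mem_iota add1n ltnS xa andbT lt0n orbN.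
- exact/CB/DC/sD.
apply: homC; split=> // x /=; rewrite !inE => /andP[_ xs].
exact/DC/sD.
Qed.

Lemma ramsey_homogeneous_arrow I n :
  ramsey_ideal I -> 1 < n -> homogeneous_arrow I n.
Proof.
move=> ramI; elim: n => // -[//|[_ _|n IHn _]]; first exact: ramI.
exact/homogeneous_arrowS/IHn.
Qed.

Lemma image_homogeneous (A : set nat) n (pi : {fset nat} -> bool) c :
  infinite_set A -> (forall s, nsubsets A n s -> pi s = c) ->
  pi @` nsubsets A n = [set c].
Proof.
move=> Ainf homA; apply/seteqP; split=> [_ [s As <-]|_ ->] /=.
  exact: homA.
by have [s As] := infinite_has_nsubset A n Ainf; exists s; rewrite ?homA.
Qed.

Lemma ramsey_arrow_omega I n : ramsey_ideal I -> 1 < n -> arrow_omega I n.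
Proof.
move=> ramI n_gt1 A posA pi.
have [H [posH HA [c homH]]] := ramsey_homogeneous_arrow I n ramI n_gt1 A posA pi.
have imH := image_homogeneous H n pi c posH.1 homH.
by case: c imH {homH} => imH; [right|left]; exists H; split=> //; case: posH.
Qed.

(** * Relations between the arrows *)

Lemma arrow_omega_lt_omega I n : arrow_omega I n -> arrow_lt_omega I n.
Proof.
move=> arrI A posA pi; have [[B [Binf BA imB]]|] := arrI A posA pi; last by right.
left=> m nm; have [s [sB cards]] := infinite_has_nsubset B m Binf.
exists s; split; first by split=> // x /sB/BA.
apply/seteqP; split=> [_ [t [ts cardt] <-]|_ ->] /=.
  by rewrite -[_ = _]/([set false] (pi t)) -imB; exists t => //; split=> // x /ts/sB.
pose t := [fset x in take n s].
have ts : [set` t] `<=` [set` s] by move=> x /=; rewrite inE => /mem_take.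
have cardt : #|` t| = n.
  by rewrite card_fseq undup_id ?take_uniq ?fset_uniq // size_takel // cards ltnW.
exists t => //.
by rewrite -[_ = _]/([set false] (pi t)) -imB; exists t => //; split=> // x /ts/sB.
Qed.

(** * From 4-sets and triples back to pairs *)

Lemma positive_split I A (p : nat -> bool) : ideal_on_omega I ->
  positive I A -> exists c, positive I [set a | A a /\ p a = c].
Proof.
move=> hI [_ IA].
have [c Ic] : exists c, ~ I [set a | A a /\ p a = c].
  apply: contrapT => noc; apply: IA.
  have Iall c : I [set a | A a /\ p a = c].
    by apply: contrapT => Ic; apply: noc; exists c.
  apply: (ideal_subset hI _ (ideal_union hI (Iall true) (Iall false))).
  by move=> a Aa; case pa : (p a); [left|right].
by exists c; split=> // fin; apply/Ic/(ideal_finite hI).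
Qed.

Lemma card_fset3 (K : choiceType) (a u v : K) :
  a != u -> a != v -> u != v -> #|` [fset a; u; v]| = 3.
Proof.
move=> au av uv.
by rewrite fsetUC cardfsU1 cardfs2 au !inE !(eq_sym v) (negPf av) (negPf uv).
Qed.

(** For a triple this compares the two pairs containing its minimum: in the other
    instances of the condition u and v coincide. *)
Definition min_uniform (pi : {fset nat} -> bool) (s : {fset nat}) : bool :=
  `[< forall a u v, a \in s -> u \in s -> v \in s -> a < u -> a < v ->
      pi [fset a; u] = pi [fset a; v] >].

Lemma min_uniform_triple pi a u v : a < u -> a < v ->
  pi [fset a; u] = pi [fset a; v] -> min_uniform pi [fset a; u; v].
Proof.
move=> au av eq_uv; apply/asboolP => x y z; rewrite !inE.
move=> /orP[/orP[]|] /eqP -> /orP[/orP[]|] /eqP -> /orP[/orP[]|] /eqP -> //;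
  rewrite ?ltnn //.
- by move=> /(ltn_trans au); rewrite ltnn.
- by move=> _ /(ltn_trans au); rewrite ltnn.
- by move=> /(ltn_trans av); rewrite ltnn.
- by move=> _ /(ltn_trans av); rewrite ltnn.
Qed.

(** Pigeonhole: three pairs {min t, x} and two colors. *)
Lemma min_uniform_four pi (t : {fset nat}) : #|` t| = 4 ->
  exists s, nsubsets [set` t] 3 s /\ min_uniform pi s.
Proof.
move=> card_t.
have [|a a_t amin] := fset_nat_min t; first by rewrite -cardfs_gt0 card_t.
have card_r : #|` (t `\ a)%fset| = 3 by move: card_t; rewrite (cardfsD1 a) a_t => -[].
have gt_r x : x \in (t `\ a)%fset -> a < x.
  by rewrite !inE => /andP[xa xt]; rewrite ltn_neqAle eq_sym xa amin.
have [u [v [u_r v_r uv eq_uv]]] : exists u v,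
    [/\ u \in (t `\ a)%fset, v \in (t `\ a)%fset, u != v & pi [fset a; u] = pi [fset a; v]].
  move: card_r (fset_uniq (t `\ a)%fset).
  have : forall x, x \in ((t `\ a)%fset : seq nat) -> x \in (t `\ a)%fset by [].
  case: (enum_fset (t `\ a)%fset) => [|u [|v [|w [|? ?]]]] //= sub _.
  rewrite !inE !negb_or => /and3P[/andP[uv uw] vw _].
  have [ur vr wr] : [/\ u \in (t `\ a)%fset, v \in (t `\ a)%fset & w \in (t `\ a)%fset].
    by split; apply: sub; rewrite !inE eqxx ?orbT.
  have [e|e1] := eqVneq (pi [fset a; u]) (pi [fset a; v]); first by exists u, v.
  have [e|e2] := eqVneq (pi [fset a; u]) (pi [fset a; w]); first by exists u, w.
  exists v, w; split=> //.
  by move: e1 e2; case: (pi _); case: (pi _); case: (pi _).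
exists [fset a; u; v]; split; last by apply: min_uniform_triple => //; exact: gt_r.
move: (gt_r _ u_r) (gt_r _ v_r) => au av.
split.
  move: u_r v_r; rewrite !inE => /andP[_ ut] /andP[_ vt] x /=.
  by rewrite !inE => /orP[/orP[]|] /eqP ->.
by apply: card_fset3 => //; rewrite neq_ltn ?au ?av.
Qed.

(** No 4-set is homogeneous of color 0 for the coloring of triples by
    [min_uniform pi], so a positive set B is homogeneous of color 1; on B the
    color of a pair is a function p of its minimum. *)
Lemma arrow_finite_ramsey I : ideal_on_omega I ->
  arrow_finite I 4 3 -> ramsey_ideal I.
Proof.
move=> hI arrI A posA pi.
have [[t [[tA card_t] im_t]]|[B [posB BA imB]]] := arrI A posA (min_uniform pi).
  have [s [st us]] := min_uniform_four pi t card_t.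
  have : [set false] (min_uniform pi s) by rewrite -im_t; exists s.
  by rewrite /= us.
have uniB a u v : B a -> B u -> B v -> a < u -> u < v ->
    pi [fset a; u] = pi [fset a; v].
  move=> Ba Bu Bv au uv; have av := ltn_trans au uv.
  have : [set true] (min_uniform pi [fset a; u; v]).
    rewrite -imB; exists [fset a; u; v] => //; split.
      by move=> x /=; rewrite !inE => /orP[/orP[]|] /eqP ->.
    by apply: card_fset3; rewrite neq_ltn ?au ?av ?uv.
  by move=> /asboolP; apply; rewrite ?inE ?eqxx ?orbT.
pose p a := `[< exists2 u, B u & a < u /\ pi [fset a; u] >].
have [c posH] := positive_split I B p hI posB.
exists [set a | B a /\ p a = c]; split=> //; first by move=> a [/BA].
exists c => s [sH cards].
have [|a as_ amin] := fset_nat_min s; first by rewrite -cardfs_gt0 cards.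
have card_r : #|` (s `\ a)%fset| = 1.
  by move: cards; rewrite (cardfsD1 a) as_ => -[].
have [|b bs' _] := fset_nat_min (s `\ a)%fset; first by rewrite -cardfs_gt0 card_r.
have [nba bs] : b != a /\ b \in s by move: bs'; rewrite !inE => /andP[].
have ab : a < b by rewrite ltn_neqAle eq_sym nba amin.
have -> : s = [fset a; b].
  apply/esym/eqP; rewrite eqEfcard cards cardfs2 (eq_sym a) nba leqnn andbT.
  by apply/fsubsetP => x; rewrite !inE => /orP[] /eqP ->.
have [[Ba <-] [Bb _]] := (sH a as_, sH b bs).
apply/idP/asboolP => [piab|[u Bu [au]]]; first by exists b.
case: (ltngtP u b) => [ub|bu|->//].
  by rewrite (uniB a u b).
by rewrite (uniB a b u).
Qed.

Theorem theorem3p20 (I : set (set nat)) (hI : ideal_on_omega I) :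
  [<-> ramsey_ideal I;
       forall n : nat, (3 <= n)%N -> arrow_omega I n;
       forall n : nat, (3 <= n)%N -> arrow_lt_omega I n;
       forall m n : nat, (3 <= n)%N -> (n < m)%N -> arrow_finite I m n].
Proof.
tfae.
- by move=> ramI n n_ge3; apply: ramsey_arrow_omega => //; exact: ltnW.
- by move=> arrI n n_ge3; exact/arrow_omega_lt_omega/arrI.
- move=> arrI m n n_ge3 nm A posA pi.
  by have [fin|pos] := arrI n n_ge3 A posA pi; [left; exact: fin|right].
- by move=> arrI; apply: arrow_finite_ramsey => //; exact: arrI.
Qed.
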